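(* Let $C/R$, $A=R[\mathbf{x}]/(f_2,\dots,f_n)$, $P$, $\Delta_2,\dots,\Delta_n$, $G(\mathbf{S})$, $\mathbf{s}$, $\psi$ and the $\sigma$-semilinear endomorphism $\phi$ of $A^\dagger$ be as in the context, and fix an end with parameter $t$ and expansion map $\xi$ as in the context. Then the expansions $\xi(\phi(x_i))$ can be computed directly. More precisely, if $H(\mathbf{S})$ is obtained from $G(\mathbf{S})$ by applying $\xi$ to the coefficients, then $H(\mathbf{S})=0$ has a unique solution $\tilde{\mathbf{s}}$ in $\bigl(\tilde\pi\,\widehat{\tilde R((t))}\bigr)^{n-1}$, this solution equals $\xi(\mathbf{s})$, and $$\xi(\phi(\mathbf{x}))=\xi(\psi(\mathbf{x}))+\xi(\psi(P))\,\tilde{\mathbf{s}}.$$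
   Context: $K$ is a finite extension of $\mathbb{Q}_p$ with valuation ring $R$, uniformiser $\pi$ and residue field $k$; $\sigma$ is an automorphism of $K$ inducing $x\mapsto x^{p'}$ on $k$ with $p'$ a power of $p$. $C\to\mathrm{Spec}(R)$ is a proper smooth curve with geometrically irreducible fibres, and $\mathrm{Spec}(A)\subset C$ is a Zariski open affine containing the generic point of the special fibre $C_k$, with $A=R[\mathbf{x}]/(f_2,\dots,f_n)$, $\mathbf{x}=(x_1,\dots,x_n)$, such that the $(n-1)\times(n-1)$ minors of $\mathrm{Jac}_{\overline f}$ generate the unit ideal of $\overline{A}=A\otimes_Rk$. $R\langle\mathbf{x}\rangle$ is the ring of power series with coefficients tending to $0$, $R\langle\mathbf{x}\rangle^\dagger$ its subring of overconvergent series, $\widehat{A}=R\langle\mathbf{x}\rangle/(f_2,\dots,f_n)$ and $A^\dagger=R\langle\mathbf{x}\rangle^\dagger/(f_2,\dots,f_n)$. $\psi$ is the $\sigma$-semilinear ring endomorphism of $R\langle\mathbf{x}\rangle$ with $\psi(x_i)=x_i^{p'}$ (applied entrywise to matrices). Matrices $P$ ($n\times(n-1)$) and $\Delta_2,\dots,\Delta_n$ ($(n-1)\times(n-1)$) over $R[\mathbf{x}]$ with $\mathrm{Jac}_fP\equiv\mathrm{Id}_{n-1}+\sum_jf_j\Delta_j\pmod\pi$ are fixed, and $G(\mathbf{S})=f^\sigma(\psi(\mathbf{x})+\psi(P)\mathbf{S})-f^{p'}-\sum_{j=2}^nf_j^{p'}\psi(\Delta_j)\mathbf{S}$ with $\mathbf{S}=(S_2,\dots,S_n)$,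 $f^\sigma=(f_j^\sigma)$, $f^{p'}=(f_j^{p'})$ column vectors. $\mathbf{s}$ is the unique solution of $G(\mathbf{S})=0$ with entries in $\pi R\langle\mathbf{x}\rangle$ (its entries are in $\pi R\langle\mathbf{x}\rangle^\dagger$), and $\phi$ is the $\sigma$-semilinear endomorphism of $A^\dagger$ induced by $\mathbf{x}\mapsto\psi(\mathbf{x})+\psi(P)\mathbf{s}$. Ends and expansions: let $\tilde K/K$ be a finite extension with valuation ring $\tilde R$ and uniformiser $\tilde\pi$, let $Q:\mathrm{Spec}(\tilde R)\to C_{\tilde R}$ be a section whose reduction $q$ in the special fibre does not lie over $\mathrm{Spec}(\overline{A})$, and let $t\in\mathcal{O}_{C_{\tilde R},q}$ be a local equation of $Q$. The $(t)$-adic completion of $\mathcal{O}_{C_{\tilde R},q}$ is $\tilde R[[t]]$. Put $\widehat{\tilde R((t))}=\{\sum_{m\in\mathbb{Z}}a_mt^m: a_m\in\tilde R,\ \lim_{m\to-\infty}a_m=0\}$. The map $\mathcal{O}_{C_{\tilde R},q}\to\tilde R[[t]]$ extends uniquely to the local ring of $C_{\tilde R}$ at the generic point of its special fibre, with values in $\widehat{\tilde R((t))}$; this gives a map on $A$, hence by $\pi$-adic continuity on $\widehat A$ (and $A^\dagger$), and by composition on $R\langle\mathbf{x}\rangle$. All these maps are denoted $\xi$ and are applied entrywise to vectors and matrices. *)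

(* Defs.v *)
From HB Require Import structures.
From mathcomp Require Import all_boot all_order all_algebra all_field.
From mathcomp Require Import boolp classical_sets topology_structure.
From mathcomp Require Import mpoly zify.

Set Implicit Arguments.
Unset Strict Implicit.
Unset Printing Implicit Defensive.

Import Order.TTheory GRing.Theory Num.Theory.

Local Open Scope classical_set_scope.
Local Open Scope ring_scope.

(* "x has valuation at least k", with 0 having valuation +oo; for a discrete
   valuation v the value [v 0] is meaningless and never used. *)
Definition vge (F : fieldType) (v : F -> int) (k : int) (x : F) : bool :=
  (x == 0) || (k <= v x).

(* A normalised discrete valuation for which F is complete. *)
Record cdval (F : fieldType) := CDVal {
  ord :> F -> int;
  ordM : forall x y, x != 0 -> y != 0 -> ord (x * y) = ord x + ord y;
  ordD : forall k x y, vge ord k x -> vge ord k y -> vge ord k (x + y);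
  ord_surj : exists2 x, x != 0 & ord x = 1;
  ord_complete : forall u : nat -> F,
    (forall k, exists N, forall i j, (N <= i)%N -> (N <= j)%N ->
       vge ord k (u i - u j)) ->
    exists l, forall k, exists N, forall i, (N <= i)%N -> vge ord k (u i - l)
}.

Section VgeTheory.
Variables (F : fieldType) (v : cdval F).

Lemma vge0 k : vge v k 0. Proof. by rewrite /vge eqxx. Qed.

Lemma ord1 : v 1 = 0.
Proof.
have := ordM v (oner_neq0 F) (oner_neq0 F); rewrite mulr1 => h.
by apply: (@addrI _ (v 1)); rewrite addr0 -h.
Qed.

Lemma ordN1 : v (- 1) = 0.
Proof.
have h1 : (- 1 : F) != 0 by rewrite oppr_eq0 oner_neq0.
have := ordM v h1 h1; rewrite mulrNN mulr1 ord1 => h.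
have : v (- 1) *+ 2 = 0 by rewrite mulr2n -h.
by move/eqP; rewrite mulrn_eq0 /= => /eqP.
Qed.

Lemma vgeM j k x y : vge v j x -> vge v k y -> vge v (j + k) (x * y).
Proof.
rewrite /vge; have [->|x0] := eqVneq x 0; first by rewrite mul0r eqxx.
have [->|y0] := eqVneq y 0; first by rewrite mulr0 eqxx.
by rewrite mulf_eq0 (negbTE x0) (negbTE y0) /= ordM //; apply: lerD.
Qed.

Lemma vge1 : vge v 0 1. Proof. by rewrite /vge ord1 lexx orbT. Qed.

Lemma vgeN k x : vge v k x -> vge v k (- x).
Proof.
move=> h; rewrite -mulN1r -[k]add0r; apply: vgeM => //.
by rewrite /vge ordN1 lexx orbT.
Qed.

Lemma vgeB k x y : vge v k x -> vge v k y -> vge v k (x - y).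
Proof. by move=> hx hy; apply: ordD => //; apply: vgeN. Qed.

Lemma vgeW j k x : j <= k -> vge v k x -> vge v j x.
Proof. by move=> jk; rewrite /vge => /orP[->|/(le_trans jk)->]; rewrite ?orbT. Qed.

Lemma vge_sep x : (forall k : nat, vge v k%:Z x) -> x = 0.
Proof.
move=> h; apply/eqP; apply/negPn/negP => x0.
have := h `|v x|.+1; rewrite /vge (negbTE x0) /= => hx.
have := le_trans hx (ler_norm (v x)); rewrite -abszE lez_nat ltnn //.
Qed.

Definition vint : {pred F} := [pred x | vge v 0 x].

Lemma vint_subring : subring_closed vint.
Proof.
split=> [|x y hx hy|x y hx hy]; rewrite ?inE; first exact: vge1.
- exact: vgeB.
- by rewrite -[0 : int]addr0; apply: vgeM.
Qed.

HB.instance Definition _ := GRing.isSubringClosed.Build F vint vint_subring.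

End VgeTheory.

Record vring (F : fieldType) (v : cdval F) :=
  VRing { vval :> F; _ : vval \in vint v }.

HB.instance Definition _ F (v : cdval F) := [isSub for @vval F v].
HB.instance Definition _ F (v : cdval F) := [Choice of vring v by <:].
HB.instance Definition _ F (v : cdval F) :=
  [SubChoice_isSubComNzRing of vring v by <:].

Record pser (n : nat) (R : comNzRingType) :=
  PSer { pcoef : 'X_{1..n} -> R }.

HB.instance Definition _ n R := gen_eqMixin (pser n R).
HB.instance Definition _ n R := gen_choiceMixin (pser n R).

Section PSer.
Variables (n : nat) (R : comNzRingType).
Implicit Types (f g h : pser n R) (m : 'X_{1..n}).

Lemma pserP f g : (forall m, pcoef f m = pcoef g m) -> f = g.
Proof. by case: f g => [f] [g] /= fg; congr PSer; apply: funext. Qed.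

Definition pser0 := PSer (fun _ : 'X_{1..n} => 0 : R).
Definition pser_add f g := PSer (fun m => pcoef f m + pcoef g m).
Definition pser_opp f := PSer (fun m => - pcoef f m).
Definition pser_of_poly (p : {mpoly R[n]}) := PSer (fun m => p@_m).
Definition pser_mul f g := PSer (fun m =>
  \sum_(k : 'X_{1..n < (mdeg m).+1, (mdeg m).+1} | m == (k.1 + k.2)%MM)
     pcoef f k.1 * pcoef g k.2).

Lemma pser_addA : associative pser_add.
Proof. by move=> f g h; apply: pserP => m /=; rewrite addrA. Qed.
Lemma pser_addC : commutative pser_add.
Proof. by move=> f g; apply: pserP => m /=; rewrite addrC. Qed.
Lemma pser_add0 : left_id pser0 pser_add.
Proof. by move=> f; apply: pserP => m /=; rewrite add0r. Qed.
Lemma pser_addN : left_inverse pser0 pser_opp pser_add.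
Proof. by move=> f; apply: pserP => m /=; rewrite addNr. Qed.

HB.instance Definition _ := GRing.isZmodule.Build (pser n R)
  pser_addA pser_addC pser_add0 pser_addN.

Definition ptrunc (d : nat) f : {mpoly R[n]} :=
  \sum_(k : 'X_{1..n < d}) pcoef f k *: 'X_[k].

Lemma ptruncE d f m : (mdeg m < d)%N -> (ptrunc d f)@_m = pcoef f m.
Proof.
move=> md; rewrite /ptrunc raddf_sum /= (bigD1 (BMultinom md)) //= mcoeffZ.
rewrite mcoeffX eqxx mulr1 big1 ?addr0 // => k /negbTE; rewrite bmeqP /= => km.
by rewrite mcoeffZ mcoeffX km mulr0.
Qed.

Lemma mdeg_le_add m (k1 k2 : 'X_{1..n}) :
  m = (k1 + k2)%MM -> (mdeg k1 <= mdeg m)%N /\ (mdeg k2 <= mdeg m)%N.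
Proof. by move=> ->; rewrite mdegD leq_addr leq_addl. Qed.

Lemma ptrunc_mulE d f g m : (mdeg m < d)%N ->
  pcoef (pser_mul f g) m = (ptrunc d f * ptrunc d g)@_m.
Proof.
move=> md; rewrite mcoeffM /=; apply: eq_bigr => -[k1 k2] /= /eqP e.
have [l1 l2] := mdeg_le_add e.
by rewrite !ptruncE //; apply: leq_ltn_trans md.
Qed.

Lemma mcoeffM_eq d (p p' q q' : {mpoly R[n]}) m : (mdeg m < d)%N ->
  (forall k, (mdeg k < d)%N -> p@_k = p'@_k) ->
  (forall k, (mdeg k < d)%N -> q@_k = q'@_k) ->
  (p * q)@_m = (p' * q')@_m.
Proof.
move=> md hp hq; rewrite !mcoeffM; apply: eq_bigr => -[k1 k2] /= /eqP e.
have [l1 l2] := mdeg_le_add e.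
by rewrite hp ?hq //; apply: leq_ltn_trans md.
Qed.

Lemma pser_mulA : associative pser_mul.
Proof.
move=> f g h; apply: pserP => m; rewrite !(@ptrunc_mulE (mdeg m).+1) //.
transitivity ((ptrunc (mdeg m).+1 f * ptrunc (mdeg m).+1 g
               * ptrunc (mdeg m).+1 h)@_m).
  rewrite -mulrA; apply: (@mcoeffM_eq (mdeg m).+1) => // k hk.
  by rewrite ptruncE // (@ptrunc_mulE (mdeg m).+1).
apply: (@mcoeffM_eq (mdeg m).+1) => // k hk.
by rewrite ptruncE // (@ptrunc_mulE (mdeg m).+1).
Qed.

Lemma pser_mulC : commutative pser_mul.
Proof.
by move=> f g; apply: pserP => m; rewrite !(@ptrunc_mulE (mdeg m).+1) // mulrC.
Qed.

Lemma pser_of_polyM p q :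
  pser_mul (pser_of_poly p) (pser_of_poly q) = pser_of_poly (p * q).
Proof. by apply: pserP => m /=; rewrite mcoeffM. Qed.

Lemma pser_mul1 : left_id (pser_of_poly 1) pser_mul.
Proof.
move=> f; apply: pserP => m; rewrite (@ptrunc_mulE (mdeg m).+1) //.
rewrite -[RHS](@ptruncE (mdeg m).+1) // -[in RHS](mul1r (ptrunc _ f)).
by apply: (@mcoeffM_eq (mdeg m).+1) => // k hk; rewrite ptruncE.
Qed.

Lemma pser_mulDl : left_distributive pser_mul pser_add.
Proof.
move=> f g h; apply: pserP => m /=; rewrite -big_split /=.
by apply: eq_bigr => k _; rewrite mulrDl.
Qed.

Lemma pser_1neq0 : pser_of_poly 1 != 0 :> pser n R.
Proof.
apply/eqP => /(congr1 (@pcoef _ _)) /(congr1 (@^~ 0%MM)) /=.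
by rewrite mcoeff1 eqxx => /eqP; rewrite oner_eq0.
Qed.

HB.instance Definition _ := GRing.Zmodule_isComNzRing.Build (pser n R)
  pser_mulA pser_mulC pser_mul1 pser_mulDl pser_1neq0.

Lemma pser_of_poly_zmod : zmod_morphism pser_of_poly.
Proof. by move=> p q; apply: pserP => m /=; rewrite mcoeffB. Qed.
Lemma pser_of_poly_monoid : monoid_morphism pser_of_poly.
Proof. by split=> // p q; rewrite -pser_of_polyM. Qed.
HB.instance Definition _ :=
  GRing.isZmodMorphism.Build {mpoly R[n]} (pser n R) pser_of_poly
    pser_of_poly_zmod.
HB.instance Definition _ :=
  GRing.isMonoidMorphism.Build {mpoly R[n]} (pser n R) pser_of_poly
    pser_of_poly_monoid.

End PSer.

Section TateDagger.
Variables (F : fieldType) (v : cdval F) (n : nat).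
Let R : comNzRingType := vring v.

(* Coefficients tending to 0. *)
Definition restricted : {pred pser n R} := [pred f | `[<
  forall k : int, exists d : nat, forall m : 'X_{1..n},
    (d <= mdeg m)%N -> vge v k (vval (pcoef f m)) >] ].

(* Convergence on a polydisc of radius > 1: the valuation of the coefficient
   of 'X_[m] is at least floor((|m| - d) / c). *)
Definition overconvergent : {pred pser n R} := [pred f | `[<
  exists c d : nat, forall (k : nat) (m : 'X_{1..n}),
    (c * k + d <= mdeg m)%N -> vge v k (vval (pcoef f m)) >] ].

Lemma vval_ge0 (a : vring v) : vge v 0 (vval a).
Proof. by case: a. Qed.

Lemma vge_sum k (I : finType) (P : pred I) (a : I -> vring v) :
  (forall i, P i -> vge v k (vval (a i))) ->
  vge v k (vval (\sum_(i | P i) a i)).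
Proof.
move=> h; apply: (big_ind (fun x : vring v => vge v k (vval x))) => //.
- exact: vge0.
- by move=> x y; apply: ordD.
Qed.

Lemma restricted_poly p : pser_of_poly p \in restricted.
Proof.
apply/asboolP => k; exists (msize p) => m hm /=.
by rewrite memN_msupp_eq0 ?vge0 // msize_mdeg_ge.
Qed.

Lemma overconvergent_poly p : pser_of_poly p \in overconvergent.
Proof.
apply/asboolP; exists 0%N, (msize p) => k m; rewrite mul0n add0n => hm /=.
by rewrite memN_msupp_eq0 ?vge0 // msize_mdeg_ge.
Qed.

Lemma restricted_subring : subring_closed restricted.
Proof.
split; first by have := restricted_poly 1; rewrite rmorph1.
- move=> f g /asboolP hf /asboolP hg; apply/asboolP => k.
  have [d1 h1] := hf k; have [d2 h2] := hg k.
  exists (maxn d1 d2) => m; rewrite geq_max => /andP[m1 m2].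
  by apply: vgeB; [apply: h1|apply: h2].
- move=> f g /asboolP hf /asboolP hg; apply/asboolP => k.
  have [d1 h1] := hf k; have [d2 h2] := hg k.
  exists (d1 + d2)%N => m hm; apply: vge_sum => -[k1 k2] /= /eqP e.
  have em : mdeg m = (mdeg k1 + mdeg k2)%N by rewrite -mdegD -e.
  have [l1|l1] := leqP d1 (mdeg k1).
    by rewrite -[k]addr0; apply: vgeM (h1 _ l1) (vval_ge0 _).
  rewrite -[k]add0r; apply: vgeM (vval_ge0 _) (h2 _ _).
  by move: hm em l1; clear; lia.
Qed.

Lemma overconvergent_restricted f : f \in overconvergent -> f \in restricted.
Proof.
move=> /asboolP[c [d h]]; apply/asboolP => k; exists (c * `|k| + d)%N => m hm.
by apply: vgeW (h _ _ hm); rewrite abszE ler_norm.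
Qed.

Lemma overconvergent_subring : subring_closed overconvergent.
Proof.
split; first by have := overconvergent_poly 1; rewrite rmorph1.
- move=> f g /asboolP[c1 [d1 h1]] /asboolP[c2 [d2 h2]]; apply/asboolP.
  exists (c1 + c2)%N, (d1 + d2)%N => k m hm.
  by apply: vgeB; [apply: h1|apply: h2]; apply: leq_trans hm; nia.
- move=> f g /asboolP[c1 [d1 h1]] /asboolP[c2 [d2 h2]]; apply/asboolP.
  pose c := (c1 + c2).+1; pose d := (d1 + d2)%N.
  exists c, (d + d + c)%N => k m hm; apply: vge_sum => -[k1 k2] /= /eqP e.
  have em : mdeg m = (mdeg k1 + mdeg k2)%N by rewrite -mdegD -e.
  pose a := ((mdeg k1 - d) %/ c)%N; pose b := ((mdeg k2 - d) %/ c)%N.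
  have bd x : (x < (x %/ c).+1 * c)%N by rewrite ltn_ceil.
  have la := bd (mdeg k1 - d)%N; have lb := bd (mdeg k2 - d)%N.
  have ua := leq_trunc_div (mdeg k1 - d) c.
  have ub := leq_trunc_div (mdeg k2 - d) c.
  rewrite -/a -/b in la lb ua ub.
  have [l1|l1] := ltnP (mdeg k1) d.
    rewrite -[k%:Z]add0r; apply: vgeM (vval_ge0 _) (h2 _ _ _); nia.
  have [l2|l2] := ltnP (mdeg k2) d.
    rewrite -[k%:Z]addr0; apply: vgeM (h1 _ _ _) (vval_ge0 _); nia.
  have hab : (k <= a + b)%N by nia.
  apply: (@vgeW _ _ _ (a%:Z + b%:Z)); first by rewrite -PoszD lez_nat.
  apply: vgeM; [apply: h1|apply: h2]; nia.
Qed.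

HB.instance Definition _ :=
  GRing.isSubringClosed.Build (pser n R) restricted restricted_subring.
HB.instance Definition _ :=
  GRing.isSubringClosed.Build (pser n R) overconvergent overconvergent_subring.

(* R<x> and R<x>^dagger, for R = vring v and x = (x_1, ..., x_n). *)
Record tate := Tate { tser :> pser n R; _ : tser \in restricted }.
Record dagger := Dagger { dser :> pser n R; _ : dser \in overconvergent }.

HB.instance Definition _ := [isSub for tser].
HB.instance Definition _ := [Choice of tate by <:].
HB.instance Definition _ := [SubChoice_isSubComNzRing of tate by <:].
HB.instance Definition _ := [isSub for dser].
HB.instance Definition _ := [Choice of dagger by <:].
HB.instance Definition _ := [SubChoice_isSubComNzRing of dagger by <:].

Definition tate_of_poly (p : {mpoly R[n]}) : tate :=
  Tate (restricted_poly p).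
Definition dagger_of_poly (p : {mpoly R[n]}) : dagger :=
  Dagger (overconvergent_poly p).
Definition tate_of_dagger (f : dagger) : tate :=
  Tate (overconvergent_restricted (valP f)).

Lemma tate_of_poly_zmod : zmod_morphism tate_of_poly.
Proof. by move=> p q; apply: val_inj; rewrite /= raddfB. Qed.
Lemma tate_of_poly_monoid : monoid_morphism tate_of_poly.
Proof.
by split=> [|p q]; apply: val_inj; rewrite /= (rmorph1, rmorphM).
Qed.
HB.instance Definition _ := GRing.isZmodMorphism.Build {mpoly R[n]} tate
  tate_of_poly tate_of_poly_zmod.
HB.instance Definition _ := GRing.isMonoidMorphism.Build {mpoly R[n]} tate
  tate_of_poly tate_of_poly_monoid.

Lemma dagger_of_poly_zmod : zmod_morphism dagger_of_poly.
Proof. by move=> p q; apply: val_inj; rewrite /= raddfB. Qed.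
Lemma dagger_of_poly_monoid : monoid_morphism dagger_of_poly.
Proof.
by split=> [|p q]; apply: val_inj; rewrite /= (rmorph1, rmorphM).
Qed.
HB.instance Definition _ := GRing.isZmodMorphism.Build {mpoly R[n]} dagger
  dagger_of_poly dagger_of_poly_zmod.
HB.instance Definition _ := GRing.isMonoidMorphism.Build {mpoly R[n]} dagger
  dagger_of_poly dagger_of_poly_monoid.

Lemma tate_of_dagger_zmod : zmod_morphism tate_of_dagger.
Proof. by move=> p q; apply: val_inj. Qed.
Lemma tate_of_dagger_monoid : monoid_morphism tate_of_dagger.
Proof. by split=> [|p q]; apply: val_inj. Qed.
HB.instance Definition _ := GRing.isZmodMorphism.Build dagger tate
  tate_of_dagger tate_of_dagger_zmod.
HB.instance Definition _ := GRing.isMonoidMorphism.Build dagger tate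
  tate_of_dagger tate_of_dagger_monoid.

End TateDagger.

(* Formal sums of a_m t^m over all integers m, with a_m tending to 0 as m
   tends to -oo. *)
Record laurent (F : fieldType) (v : cdval F) := Laurent {
  lcoef : int -> vring v;
  lcoef_null : forall k : int, exists B : nat, forall m : int,
    m < - B%:Z -> vge v k (vval (lcoef m))
}.

HB.instance Definition _ F (v : cdval F) := gen_eqMixin (laurent v).
HB.instance Definition _ F (v : cdval F) := gen_choiceMixin (laurent v).

Section Laurent.
Variables (F : fieldType) (v : cdval F).
Local Notation R := (vring v).
Implicit Types (a b c : laurent v) (m k : int).

Lemma laurentP a b : (forall m, lcoef a m = lcoef b m) -> a = b.
Proof.
case: a b => [a ha] [b hb] /= ab; have e : a = b by apply: funext.
by rewrite {}e in ha *; congr Laurent; apply: Prop_irrelevance.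
Qed.

Lemma vvalD (x y : R) : vval (x + y) = vval x + vval y. Proof. by []. Qed.
Lemma vvalN (x : R) : vval (- x) = - vval x. Proof. by []. Qed.

Definition eqv (N : int) (x y : R) : Prop := vge v N (vval (x - y)).

Lemma ge0_posz (z : int) : 0 <= z -> exists M : nat, z = M%:Z.
Proof. by case: z => // M _; exists M. Qed.

Lemma eqv_refl N x : eqv N x x.
Proof. by rewrite /eqv subrr /= vge0. Qed.
Lemma eqv_sym N x y : eqv N x y -> eqv N y x.
Proof. by rewrite /eqv -opprB => /vgeN; rewrite -vvalN opprK. Qed.
Lemma eqv_trans N y x z : eqv N x y -> eqv N y z -> eqv N x z.
Proof. by rewrite /eqv => h1 h2; have := ordD h1 h2; rewrite -vvalD addrA subrK. Qed.
Lemma eqvD N x y x' y' : eqv N x x' -> eqv N y y' -> eqv N (x + y) (x' + y').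
Proof.
by rewrite /eqv => h1 h2; have := ordD h1 h2; rewrite -vvalD opprD addrACA.
Qed.
Lemma eqvM N x y x' y' : eqv N x x' -> eqv N y y' -> eqv N (x * y) (x' * y').
Proof.
rewrite /eqv => h1 h2.
have -> : x * y - x' * y' = (x - x') * y + x' * (y - y').
  by rewrite mulrBl mulrBr addrA subrK.
apply: (@ordD _ v).
  by rewrite -[N]addr0; apply: vgeM h1 (vval_ge0 _).
by rewrite -[N]add0r; apply: vgeM (vval_ge0 _) h2.
Qed.
Lemma eqv_sum N n (x y : 'I_n -> R) : (forall i, eqv N (x i) (y i)) ->
  eqv N (\sum_i x i) (\sum_i y i).
Proof. by move=> h; rewrite /eqv -sumrB; apply: vge_sum => i _; apply: h. Qed.
Lemma eqv_eq x y : (forall N : nat, eqv N x y) -> x = y.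
Proof.
move=> h; apply/subr0_eq/val_inj => /=; exact: vge_sep h.
Qed.

Definition window (a b : int -> R) m (B1 B2 : nat) : R :=
  if m + B1%:Z + B2%:Z is Posz M then
    \sum_(k < M.+1) a (k%:Z - B1%:Z) * b (m + B1%:Z - k%:Z)
  else 0.

(* c is the sum of the a_i b_j over all i + j = m: the limit, as B tends to
   infinity, of the finite sums over i, j >= - B. *)
Definition is_conv (a b : int -> R) m (c : R) : Prop :=
  forall N : int, exists B0 : nat, forall B : nat, (B0 <= B)%N ->
    eqv N c (window a b m B B).

Definition tail (N : int) (B : nat) (a : int -> R) :=
  forall m, m < - B%:Z -> vge v N (vval (a m)).

Lemma tailW N B B' (a : int -> R) : (B <= B')%N -> tail N B a -> tail N B' a.
Proof. by move=> BB h m hm; apply: h; apply: lt_le_trans hm _; lia. Qed.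

Lemma window_pos (a b : int -> R) m B1 B2 M : m + B1%:Z + B2%:Z = M%:Z ->
  window a b m B1 B2 = \sum_(k < M.+1) a (k%:Z - B1%:Z) * b (m + B1%:Z - k%:Z).
Proof. by rewrite /window => ->. Qed.

Lemma window_neg (a b : int -> R) m B1 B2 : m + B1%:Z + B2%:Z < 0 -> window a b m B1 B2 = 0.
Proof. by rewrite /window; case: (m + _ + _). Qed.

Lemma window_stepl N (a b : int -> R) m B1 B2 : tail N B1 a ->
  eqv N (window a b m B1.+1 B2) (window a b m B1 B2).
Proof.
move=> ha; have ta : vge v N (vval (a (- B1.+1%:Z))) by apply: ha; lia.
have tm x : vge v N (vval (a (- B1.+1%:Z) * x)).
  by rewrite -[N]addr0; apply: vgeM ta (vval_ge0 _).
have [s0|s0] := ltP (m + B1.+1%:Z + B2%:Z) 0.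
  rewrite window_neg; last by lia.
  by rewrite window_neg; [exact: eqv_refl|lia].
have [M eM] : exists M : nat, m + B1.+1%:Z + B2%:Z = M%:Z.
  exact: ge0_posz.
rewrite (window_pos _ _ eM) big_ord_recl /= sub0r.
case: M eM => [|M] eM.
  by rewrite big_ord0 window_neg ?/eqv ?subr0 ?addr0 //; lia.
rewrite (@window_pos _ _ _ _ _ M); last by lia.
rewrite -[X in eqv _ _ X]add0r; apply: eqvD; first by rewrite /eqv subr0.
apply: eqv_sum => i; rewrite /bump /= add1n.
have -> : i.+1%:Z - B1.+1%:Z = i%:Z - B1%:Z by lia.
have -> : m + B1.+1%:Z - i.+1%:Z = m + B1%:Z - i%:Z by lia.
exact: eqv_refl.
Qed.

Lemma windowC (a b : int -> R) m B1 B2 : window a b m B1 B2 = window b a m B2 B1.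
Proof.
have [s0|s0] := ltP (m + B1%:Z + B2%:Z) 0; first by rewrite !window_neg //; lia.
have [M eM] : exists M : nat, m + B1%:Z + B2%:Z = M%:Z.
  exact: ge0_posz.
rewrite (window_pos _ _ eM) (@window_pos _ _ _ _ _ M); last by lia.
rewrite (reindex_inj rev_ord_inj) /=; apply: eq_bigr => i _.
have hi : (i <= M)%N by rewrite -ltnS.
rewrite mulrC; congr (b _ * a _); rewrite subSS; lia.
Qed.

Lemma window_stepr N (a b : int -> R) m B1 B2 : tail N B2 b ->
  eqv N (window a b m B1 B2.+1) (window a b m B1 B2).
Proof. by rewrite ![window a _ _ _ _]windowC; apply: window_stepl. Qed.

Lemma window_le N (a b : int -> R) m B1 B2 B1' B2' : tail N B1 a -> tail N B2 b ->
  (B1 <= B1')%N -> (B2 <= B2')%N ->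
  eqv N (window a b m B1' B2') (window a b m B1 B2).
Proof.
move=> ta tb /subnK <- /subnK <-.
apply: (@eqv_trans _ (window a b m B1 (B2' - B2 + B2))).
  elim: (B1' - B1)%N => [|d IH]; first exact: eqv_refl.
  rewrite addSn; apply: eqv_trans IH; apply: window_stepl.
  by apply: tailW ta; rewrite leq_addl.
elim: (B2' - B2)%N => [|d IH]; first exact: eqv_refl.
rewrite addSn; apply: eqv_trans IH; apply: window_stepr.
by apply: tailW tb; rewrite leq_addl.
Qed.

Lemma lcoef_tail2 N a b : exists B, tail N B (lcoef a) /\ tail N B (lcoef b).
Proof.
have [B1 h1] := lcoef_null a N; have [B2 h2] := lcoef_null b N.
exists (maxn B1 B2); split.
- exact: tailW (leq_maxl _ _) h1.
- exact: tailW (leq_maxr _ _) h2.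
Qed.

Lemma is_conv_ex a b m : exists c : R, is_conv (lcoef a) (lcoef b) m c.
Proof.
pose w B := window (lcoef a) (lcoef b) m B B.
have cauchy N : exists B0, forall B, (B0 <= B)%N -> eqv N (w B) (w B0).
  have [B0 [ta tb]] := lcoef_tail2 N a b.
  by exists B0 => B hB; apply: window_le.
have [l hl] : exists l, forall k, exists N, forall i, (N <= i)%N ->
    vge v k (vval (w i) - l).
  apply: ord_complete => k; have [B0 h] := cauchy k; exists B0 => i j hi hj.
  exact: eqv_trans (h _ hi) (eqv_sym (h _ hj)).
have l0 : l \in vint v.
  have [N h] := hl 0; have := h N (leqnn N) => /vgeN.
  by rewrite opprB => /(ordD (vval_ge0 (w N))); rewrite addrC subrK.
exists (VRing l0) => k; have [N h] := hl k; exists N => B hB.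
by apply: eqv_sym; apply: h.
Qed.

Definition lmul_coef a b m : R := xget 0 (is_conv (lcoef a) (lcoef b) m).

Lemma lmul_coefP a b m : is_conv (lcoef a) (lcoef b) m (lmul_coef a b m).
Proof. by have [c hc] := is_conv_ex a b m; apply: (xgetI 0 hc). Qed.

Lemma lmul_coefE N a b m B1 B2 :
  tail N B1 (lcoef a) -> tail N B2 (lcoef b) ->
  eqv N (lmul_coef a b m) (window (lcoef a) (lcoef b) m B1 B2).
Proof.
move=> ta tb; have [B0 h] := lmul_coefP a b m N.
apply: eqv_trans (h (maxn B0 (maxn B1 B2)) (leq_maxl _ _)) _.
by apply: window_le => //; rewrite !leq_max leqnn ?orbT.
Qed.

Lemma lmul_tail N a b B1 B2 :
  tail N B1 (lcoef a) -> tail N B2 (lcoef b) ->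
  tail N (B1 + B2) (lmul_coef a b).
Proof.
move=> ta tb m hm; have := lmul_coefE m ta tb.
by rewrite window_neg /eqv ?subr0 //; lia.
Qed.

Lemma lmul_null a b (k : int) : exists B : nat, forall m : int,
  m < - B%:Z -> vge v k (vval (lmul_coef a b m)).
Proof.
have [B [ta tb]] := lcoef_tail2 k a b.
by exists (B + B)%N; apply: lmul_tail.
Qed.

Definition lmul a b := Laurent (lmul_null a b).

Lemma ladd_null a b (k : int) : exists B : nat, forall m : int,
  m < - B%:Z -> vge v k (vval (lcoef a m + lcoef b m)).
Proof.
have [B [ta tb]] := lcoef_tail2 k a b.
by exists B => m hm; apply: ordD; [apply: ta|apply: tb].
Qed.
Definition ladd a b := Laurent (ladd_null a b).

Lemma lopp_null a (k : int) : exists B : nat, forall m : int,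
  m < - B%:Z -> vge v k (vval (- lcoef a m)).
Proof. by have [B h] := lcoef_null a k; exists B => m /h; apply: vgeN. Qed.
Definition lopp a := Laurent (lopp_null a).

Lemma lmonom_null (x : R) (i : int) (k : int) : exists B : nat, forall m : int,
  m < - B%:Z -> vge v k (vval (if m == i then x else 0)).
Proof.
exists `|i|%N => m hm; case: eqP => [e|_]; last exact: vge0.
by move: hm; rewrite e; lia.
Qed.
(* x t^i *)
Definition lmonom (x : R) (i : int) := Laurent (lmonom_null x i).

Lemma laddA : associative ladd.
Proof. by move=> a b c; apply: laurentP => m /=; rewrite addrA. Qed.
Lemma laddC : commutative ladd.
Proof. by move=> a b; apply: laurentP => m /=; rewrite addrC. Qed.
Lemma ladd0 : left_id (lmonom 0 0) ladd.
Proof. by move=> a; apply: laurentP => m /=; rewrite if_same add0r. Qed.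
Lemma laddN : left_inverse (lmonom 0 0) lopp ladd.
Proof. by move=> a; apply: laurentP => m /=; rewrite if_same addNr. Qed.

HB.instance Definition _ := GRing.isZmodule.Build (laurent v)
  laddA laddC ladd0 laddN.

Lemma lmulC : commutative lmul.
Proof.
move=> a b; apply: laurentP => m /=; apply: eqv_eq => N.
have [B [ta tb]] := lcoef_tail2 N a b.
apply: eqv_trans (lmul_coefE m ta tb) _; rewrite windowC.
exact: eqv_sym (lmul_coefE m tb ta).
Qed.

Lemma windowDl (a a' b : int -> R) m B1 B2 :
  window (fun i => a i + a' i) b m B1 B2 = window a b m B1 B2 + window a' b m B1 B2.
Proof.
rewrite /window; case: (m + _ + _) => M; last by rewrite addr0.
by rewrite -big_split /=; apply: eq_bigr => i _; rewrite mulrDl.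
Qed.

Lemma lmulDl : left_distributive lmul ladd.
Proof.
move=> a b c; apply: laurentP => m /=; apply: eqv_eq => N.
have [B0 [ta tb]] := lcoef_tail2 N a b.
have [B1 [tab tc]] := lcoef_tail2 N (ladd a b) c.
pose B := maxn B0 B1.
have {}ta : tail N B (lcoef a) by apply: tailW ta; rewrite leq_maxl.
have {}tb : tail N B (lcoef b) by apply: tailW tb; rewrite leq_maxl.
have {}tc : tail N B (lcoef c) by apply: tailW tc; rewrite leq_maxr.
have {}tab : tail N B (lcoef (ladd a b)) by apply: tailW tab; rewrite leq_maxr.
apply: eqv_trans (lmul_coefE m tab tc) _; rewrite windowDl.
by apply: eqvD; apply: eqv_sym; apply: lmul_coefE.
Qed.

Lemma lmul1 : left_id (lmonom 1 0) lmul.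
Proof.
move=> a; apply: laurentP => m /=; apply: eqv_eq => N.
have [B ta] := lcoef_null a N.
have t1 : tail N 0 (lcoef (lmonom 1 0)).
  by move=> i hi /=; case: eqP => [e|_]; [move: hi; rewrite e|exact: vge0].
apply: eqv_trans (lmul_coefE m t1 ta) _.
have [s0|s0] := ltP (m + 0%:Z + B%:Z) 0.
  by rewrite window_neg //; apply: eqv_sym; rewrite /eqv subr0; apply: ta; lia.
have [M eM] : exists M : nat, m + 0%:Z + B%:Z = M%:Z.
  exact: ge0_posz.
rewrite (window_pos _ _ eM) big_ord_recl /= mul1r big1 => [|i _].
  have -> : m + 0%:Z - 0%:Z = m by lia.
  by rewrite addr0; apply: eqv_refl.
by rewrite mul0r.
Qed.

Lemma lmulA : associative lmul.
Proof.
move=> a b c; apply: laurentP => m /=; apply: eqv_eq => N.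
have [B0 [ta tb]] := lcoef_tail2 N a b.
have [B1 tc] := lcoef_null c N.
pose B := (B0 + B1 + `|m|)%N.
have {}ta : tail N B (lcoef a) by apply: tailW ta; rewrite /B; lia.
have {}tb : tail N B (lcoef b) by apply: tailW tb; rewrite /B; lia.
have {}tc : tail N B (lcoef c) by apply: tailW tc; rewrite /B; lia.
have [M eM] : exists M : nat, m + B%:Z + (B + B)%N%:Z = M%:Z.
  by apply: ge0_posz; rewrite /B; lia.
pose P (x : laurent v) : {poly R} := \poly_(i < M.+1) lcoef x (i%:Z - B%:Z).
have PE x i : (i <= M)%N -> (P x)`_i = lcoef x (i%:Z - B%:Z).
  by move=> hi; rewrite coef_poly ltnS hi.
have key x y i : (i <= M)%N -> tail N B (lcoef x) -> tail N B (lcoef y) ->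
    eqv N (lmul_coef x y (i%:Z - (B + B)%N%:Z)) (P x * P y)`_i.
  move=> hi tx ty; apply: eqv_trans (lmul_coefE _ tx ty) _.
  rewrite (@window_pos _ _ _ _ _ i); last by lia.
  rewrite coefM; apply: eqv_sum => j; have hj : (j <= i)%N by rewrite -ltnS.
  rewrite !PE; [|lia|lia].
  have -> : i%:Z - (B + B)%N%:Z + B%:Z - j%:Z = (i - j)%N%:Z - B%:Z by lia.
  exact: eqv_refl.
have tab := lmul_tail ta tb; have tbc := lmul_tail tb tc.
apply: (@eqv_trans _ (P a * P b * P c)`_M); last first.
  apply: eqv_sym; apply: eqv_trans (@lmul_coefE _ (lmul a b) c m _ _ tab tc) _.
  rewrite (@window_pos _ _ _ _ _ M); last by lia.
  rewrite coefM; apply: eqv_sum => j; have hj : (j <= M)%N by rewrite -ltnS.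
  apply: eqvM; first exact: key.
  rewrite PE; last by lia.
  have -> : m + (B + B)%N%:Z - j%:Z = (M - j)%N%:Z - B%:Z by lia.
  exact: eqv_refl.
apply: eqv_trans (@lmul_coefE _ a (lmul b c) m _ _ ta tbc) _.
rewrite (@window_pos _ _ _ _ _ M); last by lia.
rewrite -mulrA coefM; apply: eqv_sum => j; have hj : (j <= M)%N by rewrite -ltnS.
apply: eqvM; first by rewrite PE // ; apply: eqv_refl.
have -> : m + B%:Z - j%:Z = (M - j)%N%:Z - (B + B)%N%:Z by lia.
by apply: key => //; lia.
Qed.

Lemma lmonom1_neq0 : lmonom 1 0 != 0 :> laurent v.
Proof.
apply/eqP => /(congr1 (@lcoef _ _)) /(congr1 (@^~ 0)) /= /eqP.
by rewrite oner_eq0.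
Qed.

HB.instance Definition _ := GRing.Zmodule_isComNzRing.Build (laurent v)
  lmulA lmulC lmul1 lmulDl lmonom1_neq0.

(* The power series R[[t]] inside the completed Laurent series. *)
Definition lpower : set (laurent v) := [set a | forall m, m < 0 -> lcoef a m = 0].

End Laurent.

(* Q_p, as the completion of the rationals for the p-adic valuation: the
   normalisation v(p) = 1 forces v to be p-adic on the rationals. *)
Definition is_padic (p : nat) (Qp : fieldType) (v : cdval Qp) : Prop :=
  [/\ prime p, [pchar Qp] =i pred0, v p%:R = 1 &
      forall (x : Qp) (k : int), exists r : rat, vge v k (x - ratr r)].

(* The normalised valuation w of a finite extension L extends v up to the
   ramification index e. *)
Definition extends (F : fieldType) (v : cdval F) (L : fieldExtType F)
    (w : cdval L) : Prop :=
  exists2 e : nat, (0 < e)%N &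
    forall x : F, x != 0 -> w (x%:A : L) = e%:Z * v x.

Definition uniformiser (F : fieldType) (v : cdval F) (pi : vring v) : Prop :=
  pi != 0 /\ v (vval pi) = 1.

Definition is_ideal (A : comPzRingType) (I : set A) : Prop :=
  [/\ I 0, forall a b, I a -> I b -> I (a + b) &
      forall a b, I b -> I (a * b)].

Definition is_prime_ideal (A : comPzRingType) (I : set A) : Prop :=
  [/\ is_ideal I, ~ I 1 & forall a b, I (a * b) -> I a \/ I b].

Definition ideal_gen (A : comPzRingType) (G : set A) : set A :=
  smallest (@is_ideal A) G.

(* A model of the quotient ring A / I; the zero ring is allowed. *)
Record quotient_ring (A : comPzRingType) (I : set A) := QuotientRing {
  qring :> comPzRingType;
  qpi : {rmorphism A -> qring};
  qpi_surj : forall b, exists a, qpi a = b;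
  qpi_ker : forall a, qpi a = 0 <-> I a
}.

(* The map A -> B is the localisation inverting the powers of s. *)
Definition is_localisation (A B : comPzRingType) (s : A)
    (h : {rmorphism A -> B}) : Prop :=
  [/\ exists b, h s * b = 1,
      forall b, exists n a, h s ^+ n * b = h a &
      forall a, h a = 0 -> exists n, s ^+ n * a = 0].

Record opens (T : topologicalType) :=
  Opens { oset :> set T; oopen : open oset }.

Definition opT (T : topologicalType) : opens T := Opens (@openT T).

Record ringed_space := RingedSpace {
  pts :> topologicalType;
  sec : opens pts -> comPzRingType;
  res : forall U V : opens pts, V `<=` U -> {rmorphism sec U -> sec V};
  res_id : forall (U : opens pts) (h : U `<=` U) s, res h s = s;
  res_comp : forall (U V W : opens pts) (hVU : V `<=` U) (hWV : W `<=` V) (hWU : W `<=` U) s,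
    res hWV (res hVU s) = res hWU s;
  sec_separated : forall (U : opens pts) (I : Type) (V : I -> opens pts)
    (hV : forall i, V i `<=` U),
    (forall x, oset U x -> exists i, oset (V i) x) ->
    forall s, (forall i, res (hV i) s = 0) -> s = 0;
  sec_glue : forall (U : opens pts) (I : Type) (V : I -> opens pts)
    (hV : forall i, V i `<=` U),
    (forall x, oset U x -> exists i, oset (V i) x) ->
    forall s : (forall i, sec (V i)),
    (forall i j (W : opens pts) (hi : W `<=` V i) (hj : W `<=` V j),
       res hi (s i) = res hj (s j)) ->
    exists s0, forall i, res (hV i) s0 = s i
}.

Arguments res {r U V} h.

(* The germ of s at x is a unit of the stalk at x. *)
Definition unit_at (X : ringed_space) (U : opens X) (s : sec U) (x : X) : Prop :=
  exists (V : opens X) (h : V `<=` U), oset V x /\ exists s', res h s * s' = 1.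

Definition vanishing (X : ringed_space) (U : opens X) (x : X) : set (sec U) :=
  [set s | ~ unit_at s x].

Arguments vanishing {X} U x.

Definition basic_open (X : ringed_space) (U : opens X) (s : sec U) : set X :=
  U `&` [set x | unit_at s x].

(* The canonical map from U to the spectrum of its ring of sections, which
   sends x to the prime ideal of the sections vanishing at x, is an
   isomorphism: it is well defined and bijective, the D(s) form a basis of
   the topology of U, and the sections over D(s) are the localisation at s. *)
Definition affine (X : ringed_space) (U : opens X) : Prop :=
  [/\ forall x, oset U x -> is_prime_ideal (vanishing U x),
      forall x y, oset U x -> oset U y -> vanishing U x = vanishing U y -> x = y,
      forall P : set (sec U), is_prime_ideal P ->
        exists2 x, oset U x & vanishing U x = P,
      forall (V : opens X) x, V `<=` U -> oset V x ->
        exists2 s : sec U, basic_open s x & basic_open s `<=` V &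
      forall (s : sec U) (V : opens X) (h : V `<=` U),
        oset V = basic_open s -> is_localisation s (res h)].

(* A scheme over R. A morphism to Spec R is the same as a ring morphism from R
   to the global sections. *)
Record schemeOver (R : comNzRingType) := SchemeOver {
  sch :> ringed_space;
  sch_affine : forall x : sch, exists2 U : opens sch, oset U x & affine U;
  str : {rmorphism R -> sec (opT sch)}
}.

Definition const_sec (R : comNzRingType) (X : schemeOver R) (U : opens X) (c : R) :
  sec U := @res X (opT X) U (@subsetT X U) (str X c).

Arguments const_sec {R X} U c.

(* Morphisms of locally ringed spaces; the map on sections is given for all
   pairs of open sets U, V with f(U) contained in V. *)
Record morphism (X Y : ringed_space) := Morphism {
  mfun :> X -> Y;
  mcont : continuous mfun;
  pull : forall (V : opens Y) (U : opens X),
    U `<=` mfun @^-1` V -> {rmorphism sec V -> sec U};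
  pull_res : forall (V V' : opens Y) (U U' : opens X) (h : U `<=` mfun @^-1` V)
    (h' : U' `<=` mfun @^-1` V') (hV : V' `<=` V) (hU : U' `<=` U) s,
    pull h' (res hV s) = res hU (pull h s);
  pull_local : forall (V : opens Y) (U : opens X) (h : U `<=` mfun @^-1` V) s x,
    oset U x -> unit_at (pull h s) x -> unit_at s (mfun x)
}.

Arguments pull {X Y} m {V U} h.

Lemma preim_open (X Y : ringed_space) (f : morphism X Y) (V : opens Y) :
  open (f @^-1` V).
Proof. by have /continuousP := @mcont _ _ f; apply; apply: oopen. Qed.

Definition preim_opens (X Y : ringed_space) (f : morphism X Y) (V : opens Y) :
  opens X := Opens (preim_open f V).

Definition pull_preim (X Y : ringed_space) (f : morphism X Y) (V : opens Y) :
    {rmorphism sec V -> sec (preim_opens f V)} :=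
  @pull X Y f V (preim_opens f V) (@subset_refl _ _).

(* Morphisms are compared pointwise on points and on sections: g \o f = k,
   g \o f = id and f = g. *)
Definition is_comp (X Y Z : ringed_space) (f : morphism X Y)
    (g : morphism Y Z) (k : morphism X Z) : Prop :=
  (forall x, g (f x) = k x) /\
  forall (W : opens Z) (V : opens Y) (U : opens X)
    (hg : V `<=` g @^-1` W) (hf : U `<=` f @^-1` V) (hk : U `<=` k @^-1` W) s,
    pull f hf (pull g hg s) = pull k hk s.

Definition is_comp_id (X Y : ringed_space) (f : morphism X Y)
    (g : morphism Y X) : Prop :=
  (forall x, g (f x) = x) /\
  forall (W : opens X) (V : opens Y) (U : opens X)
    (hg : V `<=` g @^-1` W) (hf : U `<=` f @^-1` V) (h : U `<=` W) s,
    pull f hf (pull g hg s) = res h s.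

Definition same_morphism (X Y : ringed_space) (f g : morphism X Y) : Prop :=
  (forall x, f x = g x) /\
  forall (V : opens Y) (U : opens X)
    (hf : U `<=` f @^-1` V) (hg : U `<=` g @^-1` V) s,
    pull f hf s = pull g hg s.

(* f lies over Spec B -> Spec R. *)
Definition over_along (R B : comNzRingType) (i : R -> B)
    (Y : schemeOver B) (X : schemeOver R) (f : morphism Y X) : Prop :=
  forall c (h : opT Y `<=` f @^-1` opT X), pull f h (str X c) = str Y (i c).

Definition is_Rmorphism (R : comNzRingType) (X Y : schemeOver R)
    (f : morphism X Y) : Prop := over_along idfun f.

(* P, with its two projections, is the fibre product of X and Y over Spec R. *)
Definition is_fibre_product (R : comNzRingType) (X Y P : schemeOver R)
    (p1 : morphism P X) (p2 : morphism P Y) : Prop :=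
  [/\ is_Rmorphism p1, is_Rmorphism p2 &
      forall (Z : schemeOver R) (a : morphism Z X) (b : morphism Z Y),
        is_Rmorphism a -> is_Rmorphism b ->
        (exists u : morphism Z P,
           [/\ is_Rmorphism u, is_comp u p1 a & is_comp u p2 b]) /\
        forall u u' : morphism Z P,
          is_comp u p1 a -> is_comp u p2 b ->
          is_comp u' p1 a -> is_comp u' p2 b -> same_morphism u u'].

(* X', with the projection p, is the base change of X along R -> B, that is,
   the fibre product of X and Spec B over Spec R; a morphism over Spec B is
   used in place of a morphism to X together with a morphism to Spec B. *)
Definition is_base_change (R B : comNzRingType) (i : {rmorphism R -> B})
    (X : schemeOver R) (X' : schemeOver B) (p : morphism X' X) : Prop :=
  over_along i p /\
  forall (Z : schemeOver B) (a : morphism Z X), over_along i a ->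
    (exists u : morphism Z X', is_Rmorphism u /\ is_comp u p a) /\
    forall u u' : morphism Z X', is_Rmorphism u -> is_comp u p a ->
      is_Rmorphism u' -> is_comp u' p a -> same_morphism u u'.

Definition closed_map (T T' : topologicalType) (f : T -> T') : Prop :=
  forall A : set T, closed A -> closed (f @` A).

Definition universally_closed (R : comNzRingType) (X : schemeOver R) : Prop :=
  forall (T P : schemeOver R) (p1 : morphism P X) (p2 : morphism P T),
    is_fibre_product p1 p2 -> closed_map p2.

(* The diagonal, which is always an immersion, has a closed image. *)
Definition separated_scheme (R : comNzRingType) (X : schemeOver R) : Prop :=
  forall (P : schemeOver R) (p1 p2 : morphism P X) (d : morphism X P),
    is_fibre_product p1 p2 -> is_comp_id d p1 -> is_comp_id d p2 ->
    closed (range d).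

Definition finite_type (R : comNzRingType) (X : schemeOver R) : Prop :=
  exists (N : nat) (U : 'I_N -> opens X),
    (forall x, exists i, oset (U i) x) /\
    forall i, affine (U i) /\
      exists (n : nat) (g : {rmorphism {mpoly R[n]} -> sec (U i)}),
        (forall c, g c%:MP = const_sec (U i) c) /\
        (forall s, exists q, g q = s).

Definition proper_scheme (R : comNzRingType) (X : schemeOver R) : Prop :=
  [/\ separated_scheme X, finite_type X & universally_closed X].

(* An isomorphism of R-algebras from R[x_1, ..., x_n] / (f_1, ..., f_m) to the
   ring of sections over U, as a surjection from R[x]. *)
Record presentation (R : comNzRingType) (X : schemeOver R) (U : opens X)
    (m n : nat) (f : 'I_m -> {mpoly R[n]}) := Presentation {
  pres :> {rmorphism {mpoly R[n]} -> sec U};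
  pres_scalar : forall c, pres c%:MP = const_sec U c;
  pres_surj : forall s, exists q, pres q = s;
  pres_ker : forall q, pres q = 0 <-> ideal_gen (range f) q
}.

Definition jacobian (R : comNzRingType) (m n : nat) (f : 'I_m -> {mpoly R[n]}) :
  'M[{mpoly R[n]}]_(m, n) := \matrix_(j, i) (f j)^`M(i).

(* The maximal minors of the Jacobian matrix of m polynomials in m + 1
   variables. *)
Definition max_minor (R : comNzRingType) (m : nat)
    (f : 'I_m -> {mpoly R[m.+1]}) (i : 'I_m.+1) : {mpoly R[m.+1]} :=
  \det (col' i (jacobian f)).

(* Smooth of relative dimension 1 over Spec R, by the Jacobian criterion. *)
Definition smooth_curve (R : comNzRingType) (X : schemeOver R) : Prop :=
  forall x : X, exists (U : opens X) (m : nat) (f : 'I_m -> {mpoly R[m.+1]})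
    (A : presentation U f),
    [/\ oset U x, affine U &
        exists a : 'I_m.+1 -> sec U, \sum_i a i * A (max_minor f i) = 1].

Definition irreducible_space (T : topologicalType) : Prop :=
  [set: T] !=set0 /\
  forall U V : set T, open U -> open V -> U !=set0 -> V !=set0 ->
    U `&` V !=set0.

(* For every morphism Spec L -> Spec R with L a field, the base change of X to
   L is irreducible. *)
Definition geom_irreducible_fibres (R : comNzRingType) (X : schemeOver R) :
    Prop :=
  forall (L : fieldType) (i : {rmorphism R -> L}) (X' : schemeOver L)
    (p : morphism X' X), is_base_change i p -> irreducible_space X'.

Definition is_Spec (R : comNzRingType) (S : schemeOver R) : Prop :=
  affine (opT S) /\ bijective (str S).

(* The fibre over the closed point of Spec R, for R a discrete valuation ring
   with uniformiser pi. *)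
Definition special_fibre (R : comNzRingType) (X : schemeOver R) (pi : R) :
  set X := [set x | ~ unit_at (str X pi) x].

Arguments special_fibre {R} X pi.

(* A model of the local ring at x, as the direct limit of the rings of
   sections over the open neighbourhoods of x. *)
Record local_ring (X : ringed_space) (x : X) := LocalRing {
  lring :> comPzRingType;
  germ : forall U : opens X, oset U x -> {rmorphism sec U -> lring};
  germ_res : forall (U V : opens X) (h : V `<=` U) (hU : oset U x) (hV : oset V x) s,
    germ hV (res h s) = germ hU s;
  germ_surj : forall a, exists (U : opens X) (hU : oset U x) (s : sec U),
    germ hU s = a;
  germ_eq0 : forall (U : opens X) (hU : oset U x) (s : sec U), germ hU s = 0 ->
    exists (V : opens X) (h : V `<=` U), oset V x /\ res h s = 0
}.

Arguments germ {X x} l {U} hU.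

(* t generates, in the local ring at Q(s0), the ideal of the section Q. *)
Definition local_equation (S X : ringed_space) (Q : morphism S X) (s0 : S)
    (O : local_ring (Q s0)) (t : O) : Prop :=
  forall (V : opens X) (hV : oset V (Q s0)) (g : sec V),
    (exists b, germ O hV g = b * t) <->
    exists (W : opens S) (h : W `<=` Q @^-1` V), oset W s0 /\ pull Q h g = 0.

(* The morphism xi of B-algebras identifies B[[t]] with the (t)-adic
   completion of O: it induces isomorphisms from O / t^n to B[[t]] / t^n. *)
Definition is_tadic_completion (F : fieldType) (v : cdval F)
    (X : schemeOver (vring v)) (x : X) (O : local_ring x) (t : O)
    (xi : {rmorphism O -> laurent v}) : Prop :=
  [/\ forall a, lpower (xi a),
      forall c, xi (germ O (U := opT X) I (str X c)) = lmonom c 0,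
      xi t = lmonom 1 1,
      forall (n : nat) a, (forall m : int, m < n%:Z -> lcoef (xi a) m = 0) ->
        exists b, a = t ^+ n * b &
      forall (n : nat) b, lpower b ->
        exists a, forall m : int, m < n%:Z -> lcoef (xi a - b) m = 0].

(* f_j^sigma(psi(x) + psi(P) S) - f_j^q - sum_i f_i^q (psi(Delta_i) S)_j, as a
   polynomial in S with coefficients in R<x>. *)
Definition Gsys (F : fieldType) (v : cdval F) (m n q : nat)
    (sigma : vring v -> vring v) (psi : tate v n -> tate v n)
    (f : 'I_m -> {mpoly (vring v)[n]})
    (P : 'M[{mpoly (vring v)[n]}]_(n, m))
    (Delta : 'I_m -> 'M[{mpoly (vring v)[n]}]_m)
    (j : 'I_m) : {mpoly (tate v n)[m]} :=
  let lin (c : 'I_m -> {mpoly (vring v)[n]}) : {mpoly (tate v n)[m]} :=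
    \sum_l (psi (tate_of_poly (c l)))%:MP * 'X_l in
  mmap (fun c => (tate_of_poly c%:MP)%:MP)
       (fun i => (psi (tate_of_poly 'X_i))%:MP + lin (P i))
       (map_mpoly sigma (f j))
  - (tate_of_poly (f j) ^+ q)%:MP
  - \sum_i (tate_of_poly (f i) ^+ q)%:MP * lin (Delta i j).

(* Main.v *)
Require Import Defs.
From mathcomp Require Import all_boot all_order all_algebra all_field.
From mathcomp Require Import boolp classical_sets topology_structure.
From mathcomp Require Import mpoly zify ring.

(* The series [xi(s)] solves [H = 0] because [xi] is a ring morphism, and it is
   divisible by the uniformiser because [xi] restricts to the inclusion on the
   constants.  For uniqueness, [xi] kills the [f_j], so that [H] is the
   polynomial system [f^sigma] evaluated at [xi(psi(x)) + xi(psi(P)) S]; since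
   [xi(psi(f_j))] is congruent to [xi(f_j) ^ q = 0], the relation on [Jac_f P]
   makes its linear part the identity modulo the uniformiser.  The difference
   of two solutions is then divisible by every power of the uniformiser. *)

Set Implicit Arguments.
Unset Strict Implicit.
Unset Printing Implicit Defensive.

Import Order.TTheory GRing.Theory Num.Theory.

Local Open Scope classical_set_scope.
Local Open Scope ring_scope.

(** Constants and variables generate the polynomial ring, so a property stable under sums and
    products need only be checked on them. *)
Lemma mpoly_ring_ind (n : nat) (R : comNzRingType)
    (T : {mpoly R[n]} -> Prop) :
  (forall c, T c%:MP) -> (forall i, T 'X_i) ->
  (forall p q, T p -> T q -> T (p + q)) ->
  (forall p q, T p -> T q -> T (p * q)) -> forall p, T p.
Proof.
move=> TC TX TD TM; elim/mpolyind => [|c k p _ _ Tp].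
  by rewrite -mpolyC0; apply/TC.
apply/TD => //; rewrite -mul_mpolyC; apply/TM => //.
rewrite mpolyXE_id; apply: (big_ind T) => [|p1 p2|i _]; first by apply/TC.
  by apply/TM.
by elim: (k i) => [|d IH]; rewrite ?expr0 ?exprS; [apply/TC|apply/TM].
Qed.

(** * Divisibility and the Frobenius congruence for powers of sums *)

Section Dvd.
Variable B : comNzRingType.
Implicit Types c x y : B.

Definition cdvd c x : Prop := exists b, x = c * b.

Lemma cdvd0 c : cdvd c 0.
Proof. by exists 0; rewrite mulr0. Qed.

Lemma cdvdD c x y : cdvd c x -> cdvd c y -> cdvd c (x + y).
Proof. by move=> [u ->] [w ->]; exists (u + w); rewrite mulrDr. Qed.

Lemma cdvdN c x : cdvd c x -> cdvd c (- x).
Proof. by move=> [u ->]; exists (- u); rewrite mulrN. Qed.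

Lemma cdvdB c x y : cdvd c x -> cdvd c y -> cdvd c (x - y).
Proof. by move=> hx hy; apply: cdvdD => //; apply: cdvdN. Qed.

Lemma cdvdMr c x y : cdvd c x -> cdvd c (x * y).
Proof. by move=> [u ->]; exists (u * y); rewrite mulrA. Qed.

Lemma cdvdMl c x y : cdvd c y -> cdvd c (x * y).
Proof. by rewrite mulrC; apply: cdvdMr. Qed.

Lemma cdvdM c c' x y : cdvd c x -> cdvd c' y -> cdvd (c * c') (x * y).
Proof. by move=> [u ->] [w ->]; exists (u * w); rewrite mulrACA. Qed.

Lemma cdvd_trans c x y : cdvd c x -> cdvd x y -> cdvd c y.
Proof. by move=> cx [u ->]; apply: cdvdMr. Qed.

Lemma cdvd_sum c (I : finType) (F : I -> B) :
  (forall i, cdvd c (F i)) -> cdvd c (\sum_i F i).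
Proof.
by move=> h; apply: (big_ind (cdvd c)) => //; [apply: cdvd0|apply: cdvdD].
Qed.

Lemma cdvd_subX c x y q : cdvd c (x - y) -> cdvd c (x ^+ q - y ^+ q).
Proof. by rewrite subrXX; apply: cdvdMr. Qed.

(** The inner binomial coefficients are divisible by [p]. *)
Lemma cdvd_exprD_prime p x y : prime p ->
  cdvd p%:R ((x + y) ^+ p - (x ^+ p + y ^+ p)).
Proof.
case: p => [|[|p]] // pp; rewrite exprDn big_ord_recl big_ord_recr /=.
rewrite bin0 subn0 expr0 mulr1 mulr1n /bump /= add1n subnn expr0 mul1r binn.
rewrite mulr1n [X in X - _]addrA addrAC -[X in _ - X](addrC (y ^+ _)).
rewrite [X in X - _](_ : _ =
  (\sum_(i < p.+1) (x ^+ (p.+2 - i.+1) * y ^+ i.+1) *+ 'C(p.+2, i.+1))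
  + (y ^+ p.+2 + x ^+ p.+2)); last by ring.
rewrite addrK; apply: cdvd_sum => i.
have /dvdnP[k ->] : (p.+2 %| 'C(p.+2, i.+1))%N.
  by apply: prime_dvd_bin => //=; rewrite ltnS ltn_ord.
by exists (x ^+ (p.+2 - i.+1) * y ^+ i.+1 *+ k); rewrite mulrnA mulr_natl.
Qed.

(** Induction on [a]: taking [p]-th powers preserves the congruence, and the prime case then splits
    the power of the sum. *)
Lemma cdvd_exprD c p a x y : prime p -> cdvd c p%:R ->
  cdvd c ((x + y) ^+ (p ^ a) - (x ^+ (p ^ a) + y ^+ (p ^ a))).
Proof.
move=> pp cp; elim: a => [|a IH]; first by rewrite !expr1 subrr; apply: cdvd0.
rewrite expnSr !exprM; set u := x ^+ _; set w := y ^+ _.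
rewrite -(subrK ((u + w) ^+ p) (_ ^+ p)) -[X in cdvd c X]addrA.
apply: cdvdD; first exact: cdvd_subX.
exact: cdvd_trans cp (cdvd_exprD_prime _ _ pp).
Qed.

End Dvd.

(** * First-order Taylor expansion and uniqueness of Hensel lifts *)

Lemma mmap_taylor (n : nat) (R B : comNzRingType) (h : {rmorphism R -> B})
    (c : B) (k : nat) (w u u' : 'I_n -> B) (g : {mpoly R[n]}) :
  (forall i, cdvd c (u i - w i)) -> (forall i, cdvd c (u' i - w i)) ->
  (forall i, cdvd (c ^+ k) (u i - u' i)) ->
  cdvd (c ^+ k.+1) (mmap h u g - mmap h u' g
    - \sum_i mmap h w g^`M(i) * (u i - u' i)).
Proof.
move=> hu hu' huu'.
pose D g := \sum_i mmap h w g^`M(i) * (u i - u' i).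
(* The congruences to the value at [w] are carried along because the derivatives are taken at [w],
   not at [u']; the product case needs them. *)
suff [] : [/\ cdvd c (mmap h u g - mmap h w g),
              cdvd c (mmap h u' g - mmap h w g) &
              cdvd (c ^+ k.+1) (mmap h u g - mmap h u' g - D g)] by [].
have cD q : cdvd (c ^+ k) (D q) by apply: cdvd_sum => i; apply: cdvdMl.
elim/mpoly_ring_ind: g => [x|i|p q [p1 p2 p3] [q1 q2 q3]
                          |p q [p1 p2 p3] [q1 q2 q3]].
- rewrite !mmapC /D big1 ?subrr => [|j _]; last first.
    by rewrite mderivC raddf0 mul0r.
  by split; rewrite ?subrr; apply: cdvd0.
- rewrite !mmapX !mmap1U; split => //.
  rewrite /D (bigD1 i) //= big1 => [|j ji].
    rewrite mderivX mnm1E eqxx scale1r addr0.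
    have -> : (U_(i) - U_(i) = 0)%MM.
      by apply/mnmP => l; rewrite mnmBE subnn mnm0E.
    by rewrite mpolyX0 rmorph1 mul1r subrr; apply: cdvd0.
  by rewrite mderivX mnm1E eq_sym (negbTE ji) scale0r raddf0 mul0r.
- have -> : D (p + q) = D p + D q.
    rewrite /D -big_split; apply: eq_bigr => i _.
    by rewrite /= mderivD raddfD mulrDl.
  have DB (x y x' y' : B) : x + y - (x' + y') = x - x' + (y - y') by ring.
  rewrite !rmorphD /=; split.
  + by rewrite DB; apply: cdvdD.
  + by rewrite DB; apply: cdvdD.
  + by rewrite [X in X - (_ + _)]DB DB; apply: cdvdD.
- have -> : D (p * q) = D p * mmap h w q + mmap h w p * D q.
    rewrite /D mulr_suml mulr_sumr -big_split; apply: eq_bigr => i _ /=.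
    by rewrite mderivM rmorphD !rmorphM /=; ring.
  rewrite !rmorphM /=.
  move: p1 p2 p3 (cD p) q1 q2 q3 (cD q).
  move: (mmap h u p) (mmap h u' p) (mmap h w p) (D p) => pu pu' pw dp.
  move: (mmap h u q) (mmap h u' q) (mmap h w q) (D q) => qu qu' qw dq.
  move=> p1 p2 p3 cp q1 q2 q3 cq; split.
  + have -> : pu * qu - pw * qw = (pu - pw) * qu + pw * (qu - qw) by ring.
    by apply: cdvdD; [apply: cdvdMr|apply: cdvdMl].
  + have -> : pu' * qu' - pw * qw = (pu' - pw) * qu' + pw * (qu' - qw) by ring.
    by apply: cdvdD; [apply: cdvdMr|apply: cdvdMl].
  (* In the two cross terms one factor is divisible by [c] and the other by [c ^+ k]. *)
  have -> : pu * qu - pu' * qu' - (dp * qw + pw * dq) =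
    pu * (qu - qu' - dq) + (pu - pw) * dq
    + ((pu - pu' - dp) * qu' + (qu' - qw) * dp) by ring.
  apply: cdvdD; apply: cdvdD; rewrite ?exprS.
  + by rewrite -exprS; apply: cdvdMl.
  + exact: cdvdM.
  + by rewrite -exprS; apply: cdvdMr.
  + exact: cdvdM.
Qed.

(** If [S] and [S'] agree modulo [c ^+ k], Taylor expansion shows that the Jacobian times [M] kills
    their difference modulo [c ^+ k.+1]. That matrix is the identity modulo [c], so the solutions
    agree to one order more. *)
Lemma hensel_unique (n m : nat) (R B : comNzRingType)
    (chi : {rmorphism {mpoly R[n]} -> B}) (c : B)
    (f : 'I_m -> {mpoly R[n]}) (M : 'I_n -> 'I_m -> B) (S S' : 'I_m -> B) :
  let F (T : 'I_m -> B) j := mmap (chi \o @mpolyC n R)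
    (fun i => chi 'X_i + \sum_l M i l * T l) (f j) in
  (forall x, (forall k, cdvd (c ^+ k) x) -> x = 0) ->
  (forall j l, cdvd c (\sum_i chi (f j)^`M(i) * M i l - (j == l)%:R)) ->
  (forall j, cdvd c (S j)) -> (forall j, cdvd c (S' j)) ->
  (forall j, F S j = F S' j) -> S = S'.
Proof.
move=> F sep hJ cS cS' FS; apply/funext => j; apply/subr0_eq/sep => k.
elim: k j => [|k IH] j; first by exists (S j - S' j); rewrite expr0 mul1r.
pose w i := chi 'X_i; pose u (T : 'I_m -> B) i := w i + \sum_l M i l * T l.
have chiE g : mmap (chi \o @mpolyC n R) w g = chi g.
  elim/mpoly_ring_ind: g => [x|i|p q hp hq|p q hp hq].
  - by rewrite mmapC.
  - by rewrite mmapX mmap1U.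
  - by rewrite !rmorphD /= hp hq.
  - by rewrite !rmorphM /= hp hq.
have uE T i : u T i - w i = \sum_l M i l * T l by rewrite /u addrC addKr.
have uSS' i : u S i - u S' i = \sum_l M i l * (S l - S' l).
  rewrite /u opprD addrACA subrr add0r -sumrB.
  by apply: eq_bigr => l _; rewrite mulrBr.
have := @mmap_taylor _ _ _ (chi \o @mpolyC n R) c k w (u S) (u S') (f j).
have -> : mmap (chi \o @mpolyC n R) (u S) (f j)
    = mmap (chi \o @mpolyC n R) (u S') (f j) by apply: FS.
rewrite subrr sub0r => /(_ _ _ _)/cdvdN; rewrite opprK.
(* Splitting off the identity matrix isolates [S j - S' j]; the remaining sum gains a factor [c]. *)
have -> : \sum_i mmap (chi \o @mpolyC n R) w (f j)^`M(i) * (u S i - u S' i) =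
   \sum_l (\sum_i chi (f j)^`M(i) * M i l - (j == l)%:R) * (S l - S' l)
   + (S j - S' j).
  under eq_bigr => i _ do rewrite uSS' mulr_sumr chiE.
  rewrite exchange_big /=.
  under [X in _ = X + _]eq_bigr => l _ do rewrite mulrBl mulr_suml.
  rewrite sumrB [X in _ = _ - X + _](bigD1 j) //= eqxx mul1r.
  rewrite [X in _ - (_ + X) + _]big1 ?addr0.
    rewrite subrK; apply: eq_bigr => l _; apply: eq_bigr => i _.
    by rewrite mulrA.
  by move=> l /negbTE; rewrite eq_sym => ->; rewrite mul0r.
set E := \sum_l _ => hT.
have cE : cdvd (c ^+ k.+1) E.
  by apply: cdvd_sum => l; rewrite exprS; apply: cdvdM.
rewrite -[S j - S' j](addKr E) addrC; apply: cdvdB => //; apply: hT.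
- by move=> i; rewrite uE; apply: cdvd_sum => l; apply: cdvdMl.
- by move=> i; rewrite uE; apply: cdvd_sum => l; apply: cdvdMl.
- by move=> i; rewrite uSS'; apply: cdvd_sum => l; apply: cdvdMl.
Qed.

(** * Evaluation of polynomials and ring morphisms *)

Lemma meval_map_mpoly (m : nat) (R B : comNzRingType) (h : {rmorphism R -> B})
    (T : 'I_m -> B) (g : {mpoly R[m]}) : (map_mpoly h g).@[T] = mmap h T g.
Proof.
elim/mpoly_ring_ind: g => [x|i|p q hp hq|p q hp hq].
- by rewrite map_mpolyC mevalC mmapC.
- by rewrite map_mpolyX mevalXU mmapX mmap1U.
- by rewrite !rmorphD /= hp hq.
- by rewrite !rmorphM /= hp hq.
Qed.

Lemma rmorph_meval (m : nat) (R B : comNzRingType) (h : {rmorphism R -> B})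
    (T : 'I_m -> R) (g : {mpoly R[m]}) :
  h g.@[T] = (map_mpoly h g).@[h \o T].
Proof.
elim/mpoly_ring_ind: g => [x|i|p q hp hq|p q hp hq].
- by rewrite map_mpolyC !mevalC.
- by rewrite map_mpolyX !mevalXU.
- by rewrite !rmorphD /= hp hq.
- by rewrite !rmorphM /= hp hq.
Qed.

(** Meant for the first term of [Gsys]: substituting polynomials in [S] and then specialising [S] is
    a single evaluation. *)
Lemma mmap_mmap (n m : nat) (R0 R A B : comNzRingType)
    (sigma : {rmorphism R0 -> R}) (h : {rmorphism R -> A})
    (h' : {rmorphism A -> B}) (u : 'I_n -> {mpoly A[m]}) (T : 'I_m -> B)
    (g : {mpoly R0[n]}) :
  mmap h' T (mmap (@mpolyC m A \o h) u (map_mpoly sigma g))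
  = mmap (h' \o h \o sigma) (fun i => mmap h' T (u i)) g.
Proof.
elim/mpoly_ring_ind: g => [x|i|p q hp hq|p q hp hq].
- by rewrite map_mpolyC !mmapC.
- by rewrite map_mpolyX !mmapX !mmap1U.
- by rewrite !rmorphD /= hp hq.
- by rewrite !rmorphM /= hp hq.
Qed.

(** * Constants in Laurent series, the Frobenius lift and the system [Gsys] *)

Section Tate.
Variables (F : fieldType) (v : cdval F) (n m : nat).
Local Notation R := (vring v).

Lemma uniformiser_dvd (pi x : R) :
  uniformiser pi -> vge v 1 (vval x) -> cdvd pi x.
Proof.
move=> [pi0 vpi] hx.
have p0 : vval pi != 0.
  by apply: contra pi0 => /eqP h; apply/eqP/val_inj.
have [->|x0] := eqVneq x 0; first exact: cdvd0.
have {}x0 : vval x != 0 by apply: contra x0 => /eqP h; apply/eqP/val_inj.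
have hy : vval x / vval pi \in vint v.
  have y0 : vval x / vval pi != 0 by rewrite mulf_neq0 ?invr_neq0.
  rewrite inE /vge.
  have e : v (vval x) = v (vval x / vval pi) + 1 by rewrite -vpi -ordM // divfK.
  by move: hx; rewrite /vge (negbTE x0) (negbTE y0) /= e; lia.
by exists (VRing hy); apply: val_inj; rewrite /= mulrC divfK.
Qed.

(** A constant has no negative part, so the windows approximating the product may start at 0, where
    only their first term is nonzero. *)
Lemma lcoef_lmonom0M (c : R) (y : laurent v) i :
  lcoef (lmonom c 0 * y) i = c * lcoef y i.
Proof.
apply: eqv_eq => N; have [b tb] := lcoef_null y N.
have t0 : tail N 0 (lcoef (lmonom c 0)).
  by move=> j hj /=; case: eqP => [e|_]; [move: hj; rewrite e|exact: vge0].
apply: eqv_trans (lmul_coefE i t0 tb) _.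
(* An empty window means that [i] lies in the tail of [y], where both sides are small. *)
have [s0|s0] := ltP (i + 0%:Z + b%:Z) 0.
  rewrite window_neg //; apply: eqv_sym; rewrite /eqv subr0 -[N%:Z]add0r.
  by apply: vgeM (vval_ge0 _) _; apply: tb; lia.
have [M eM] := ge0_posz s0.
rewrite (window_pos _ _ eM) big_ord_recl /= big1 => [|j _];
  last by rewrite mul0r.
have -> : i + 0%:Z - 0%:Z = i by lia.
by rewrite addr0; apply: eqv_refl.
Qed.

Lemma lmonom0_dvd (c d : R) : cdvd c d -> cdvd (lmonom c 0) (lmonom d 0).
Proof.
move=> [b ->]; exists (lmonom b 0); apply: laurentP => i.
by rewrite lcoef_lmonom0M /=; case: eqP; rewrite ?mulr0.
Qed.

(** Each coefficient of a multiple of the [k]-th power has valuation at least [k]. *)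
Lemma uniformiser_power_sep (pi : R) (x : laurent v) : uniformiser pi ->
  (forall k, cdvd (lmonom pi 0 ^+ k) x) -> x = 0.
Proof.
move=> [_ vpi] hx; apply: laurentP => i; rewrite [RHS]/= if_same.
apply: val_inj; apply: (@vge_sep _ v) => k.
have [y ->] := hx k; elim: k y => [|k IH] y; first exact: vval_ge0.
rewrite exprS -mulrA lcoef_lmonom0M -addn1 PoszD addrC; apply: vgeM (IH _).
by rewrite /vge vpi lexx orbT.
Qed.

(** Modulo [pi], both [psi] and the [p ^ a]-th power are additive and multiplicative, and they agree
    on constants and variables. *)
Lemma frobenius_lift_dvd (p a : nat) (pi : R) (sigma : R -> R)
    (psi : {rmorphism tate v n -> tate v n}) (g : {mpoly R[n]}) :
  prime p -> cdvd pi p%:R ->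
  (forall x, cdvd pi (sigma x - x ^+ (p ^ a))) ->
  (forall c, psi (tate_of_poly c%:MP) = tate_of_poly (sigma c)%:MP) ->
  (forall i, psi (tate_of_poly 'X_i) = tate_of_poly 'X_i ^+ (p ^ a)) ->
  cdvd (tate_of_poly pi%:MP : tate v n)
    (psi (tate_of_poly g) - tate_of_poly g ^+ (p ^ a)).
Proof.
move=> pp [p0 pip0] hsigma psiC psiX.
have dvdC c x : cdvd c x ->
    cdvd (tate_of_poly c%:MP : tate v n) (tate_of_poly x%:MP).
  by move=> [b ->]; exists (tate_of_poly b%:MP); rewrite !rmorphM.
have cp : cdvd (tate_of_poly pi%:MP : tate v n) p%:R.
  by have := dvdC pi p%:R (ex_intro _ p0 pip0); rewrite !rmorph_nat.
elim/mpoly_ring_ind: g => [x|i|g h hg hh|g h hg hh].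
- by rewrite psiC -!rmorphXn -!rmorphB /=; apply: dvdC.
- by rewrite psiX subrr; apply: cdvd0.
- rewrite !rmorphD /=.
  have := cdvd_exprD a (tate_of_poly g) (tate_of_poly h) pp cp.
  move: hg hh; set u := tate_of_poly g; set w := tate_of_poly h => hg hh hD.
  have -> : psi u + psi w - (u + w) ^+ (p ^ a) =
    (psi u - u ^+ (p ^ a)) + (psi w - w ^+ (p ^ a))
    - ((u + w) ^+ (p ^ a) - (u ^+ (p ^ a) + w ^+ (p ^ a))) by ring.
  by apply: cdvdB => //; apply: cdvdD.
- rewrite !rmorphM /= exprMn; move: hg hh.
  move: (tate_of_poly g) (tate_of_poly h) => u w hg hh.
  have -> : psi u * psi w - u ^+ (p ^ a) * w ^+ (p ^ a) =
    (psi u - u ^+ (p ^ a)) * psi w + u ^+ (p ^ a) * (psi w - w ^+ (p ^ a)).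
    by ring.
  by apply: cdvdD; [apply: cdvdMr|apply: cdvdMl].
Qed.

(* If [xi] kills the [f j], only the first term of [Gsys] survives. *)
Lemma meval_Gsys (B : comNzRingType) (xi : {rmorphism tate v n -> B}) (q : nat)
    (sigma : {rmorphism R -> R}) (psi : {rmorphism tate v n -> tate v n})
    (f : 'I_m -> {mpoly R[n]}) P Delta (T : 'I_m -> B) j :
  (0 < q)%N -> (forall j, xi (tate_of_poly (f j)) = 0) ->
  (forall c, psi (tate_of_poly c%:MP) = tate_of_poly (sigma c)%:MP) ->
  (map_mpoly xi (Gsys q sigma psi f P Delta j)).@[T] =
  mmap (xi \o psi \o @tate_of_poly _ v n \o @mpolyC n R)
    (fun i => xi (psi (tate_of_poly 'X_i))
              + \sum_l xi (psi (tate_of_poly (P i l))) * T l) (f j).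
Proof.
move=> q0 xif psiC; rewrite meval_map_mpoly /Gsys.
have linE c : mmap xi T (\sum_l (psi (tate_of_poly (c l)))%:MP * 'X_l) =
    \sum_l xi (psi (tate_of_poly (c l))) * T l.
  rewrite rmorph_sum; apply: eq_bigr => l _.
  by rewrite /= rmorphM /= mmapC mmapX mmap1U.
have fq0 i : mmap xi T (tate_of_poly (f i) ^+ q)%:MP = 0.
  by rewrite mmapC /= rmorphXn /= xif expr0n (gtn_eqF q0).
have Delta0 (lin : 'I_m -> {mpoly (tate v n)[m]}) :
    mmap xi T (\sum_i (tate_of_poly (f i) ^+ q)%:MP * lin i) = 0.
  by rewrite rmorph_sum big1 // => i _; rewrite rmorphM /= fq0 mul0r.
rewrite !rmorphB /= fq0 Delta0 !subr0.
have -> := @mmap_mmap n m R R (tate v n) B sigma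
  (@tate_of_poly _ v n \o @mpolyC n R) xi
  (fun i => (psi (tate_of_poly 'X_i))%:MP
     + \sum_l (psi (tate_of_poly (P i l)))%:MP * 'X_l) T (f j).
(* On constants [psi] is [sigma], so the twist of [f j] is absorbed by sending its coefficients
   through [psi]. *)
congr mmap; apply/funext => i; first by rewrite /= psiC.
by rewrite rmorphD /= mmapC linE.
Qed.

End Tate.

(** * Valuations in extensions and constant sections *)

Lemma extends_vge (F : fieldType) (v : cdval F) (L : fieldExtType F)
    (w : cdval L) (x : F) : extends v w -> vge v 1 x -> vge w 1 (x%:A : L).
Proof.
move=> [e e0 hw]; rewrite /vge; have [->|x0] := eqVneq x 0.
  by rewrite scale0r eqxx.
by rewrite hw //= => h; rewrite (_ : 1 <= _) ?orbT //; nia.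
Qed.

Lemma padic_prime_vge (p : nat) (Qp : fieldType) (vp : cdval Qp)
    (K : fieldExtType Qp) (v : cdval K) :
  is_padic p vp -> extends vp v -> vge v 1 (p%:R : K).
Proof.
move=> [_ _ vpp _] hv; have -> : p%:R = p%:R%:A :> K by rewrite scaler_nat.
by apply: extends_vge hv _; rewrite /vge vpp lexx orbT.
Qed.

Lemma is_ideal_gen (A : comPzRingType) (G : set A) x : G x -> ideal_gen G x.
Proof. by move=> Gx I [_ GI]; apply: GI. Qed.

Lemma pull_preim_const_sec (R B : comNzRingType) (i : R -> B)
    (Y : schemeOver B) (X : schemeOver R) (g : morphism Y X) (U : opens X) c :
  over_along i g ->
  pull_preim g U (const_sec U c) = const_sec (preim_opens g U) (i c).
Proof.
by move=> gi; rewrite /const_sec -(gi c (@subsetT _ _)); apply: pull_res.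
Qed.

Theorem theorem7p2
  (* the field K, its valuation ring R = vring v, and sigma *)
  (p a : nat) (Qp : fieldType) (vp : cdval Qp) (hQp : is_padic p vp)
  (K : fieldExtType Qp) (v : cdval K) (hv : extends vp v)
  (pi : vring v) (hpi : uniformiser pi)
  (sigma : {rmorphism K -> K}) (sigma_bij : bijective sigma)
  (sigmaR : {rmorphism vring v -> vring v})
  (hsigmaR : forall x, vval (sigmaR x) = sigma (vval x))
  (sigma_frob : forall x, exists y, sigmaR x = x ^+ (p ^ a) + pi * y)
  (* the curve C and the affine open U = Spec A *)
  (C : schemeOver (vring v))
  (C_proper : proper_scheme C) (C_smooth : smooth_curve C)
  (C_irr : geom_irreducible_fibres C)
  (U : opens C) (U_affine : affine U)
  (eta0 : C) (heta0 : closure [set eta0] = special_fibre C pi)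
  (hU : oset U eta0)
  (m : nat) (f : 'I_m -> {mpoly (vring v)[m.+1]}) (A : presentation U f)
  (hminors : exists (b : 'I_m.+1 -> sec U) (c : sec U),
     \sum_i b i * A (max_minor f i) = 1 + const_sec U pi * c)
  (* psi, P, Delta and the solution s of G(S) = 0 *)
  (psi : {rmorphism tate v m.+1 -> tate v m.+1})
  (psi_semilinear : forall c,
     psi (tate_of_poly c%:MP) = tate_of_poly (sigmaR c)%:MP)
  (psi_X : forall i, psi (tate_of_poly 'X_i) = tate_of_poly 'X_i ^+ (p ^ a))
  (P : 'M[{mpoly (vring v)[m.+1]}]_(m.+1, m))
  (Delta : 'I_m -> 'M[{mpoly (vring v)[m.+1]}]_m)
  (hP : exists E : 'M[{mpoly (vring v)[m.+1]}]_m,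
     jacobian f *m P = 1%:M + \sum_j f j *: Delta j + pi%:MP *: E)
  (s : 'I_m -> tate v m.+1)
  (s_pi : forall j, exists b : dagger v m.+1,
     s j = tate_of_poly pi%:MP * tate_of_dagger b)
  (s_sol : forall j, (Gsys (p ^ a) sigmaR psi f P Delta j).@[s] = 0)
  (* the completions of A and the endomorphism phi of A^dagger *)
  (Ahat : quotient_ring (ideal_gen (range (fun j => tate_of_poly (f j)))))
  (Adag : quotient_ring
            (ideal_gen (range (fun j => @dagger_of_poly _ v _ (f j)))))
  (iota : {rmorphism Adag -> Ahat})
  (hiota : forall g : dagger v m.+1,
     iota (qpi Adag g) = qpi Ahat (tate_of_dagger g))
  (phi : {rmorphism Adag -> Adag})
  (phi_semilinear : forall c,
     phi (qpi Adag (dagger_of_poly c%:MP))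
     = qpi Adag (dagger_of_poly (sigmaR c)%:MP))
  (y : 'I_m.+1 -> dagger v m.+1)
  (hy : forall i, tate_of_dagger (y i)
     = psi (tate_of_poly 'X_i) + \sum_l psi (tate_of_poly (P i l)) * s l)
  (phi_X : forall i, phi (qpi Adag (dagger_of_poly 'X_i)) = qpi Adag (y i))
  (* the extension Kt of K and the base change Ct of C *)
  (Kt : fieldExtType K) (vt : cdval Kt) (hvt : extends v vt)
  (pit : vring vt) (hpit : uniformiser pit)
  (incl : {rmorphism vring v -> vring vt})
  (hincl : forall x, vval (incl x) = (vval x)%:A)
  (Ct : schemeOver (vring vt)) (pr : morphism Ct C)
  (hpr : is_base_change incl pr)
  (* the section Q, its reduction q = Q z, and its local equation t *)
  (Z : schemeOver (vring vt)) (hZ : is_Spec Z) (z : Z) (hz : closed [set z])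
  (Q : morphism Z Ct) (hQ : is_Rmorphism Q)
  (hq : ~ oset U (pr (Q z)))
  (Oq : local_ring (Q z)) (t : Oq) (ht : local_equation t)
  (* the expansion maps, on the local ring at q, on the local ring at the
     generic point of the special fibre, and on the completion of A *)
  (xiq : {rmorphism Oq -> laurent vt}) (hxiq : is_tadic_completion t xiq)
  (eta : Ct) (heta : closure [set eta] = special_fibre Ct pit)
  (hetaU : oset (preim_opens pr U) eta)
  (Oeta : local_ring eta) (xieta : {rmorphism Oeta -> laurent vt})
  (hxieta : forall (V : opens Ct) (hVq : oset V (Q z)) (hVeta : oset V eta)
     (g : sec V), xieta (germ Oeta hVeta g) = xiq (germ Oq hVq g))
  (xihat : {rmorphism Ahat -> laurent vt})
  (hxihat : forall g : {mpoly (vring v)[m.+1]},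
     xihat (qpi Ahat (tate_of_poly g))
     = xieta (germ Oeta hetaU (pull_preim pr U (A g)))) :
  let xi : tate v m.+1 -> laurent vt := fun g => xihat (qpi Ahat g) in
  let xidag : Adag -> laurent vt := fun b => xihat (iota b) in
  let H (j : 'I_m) := map_mpoly xi (Gsys (p ^ a) sigmaR psi f P Delta j) in
  exists st : 'I_m -> laurent vt,
    [/\ (forall j, exists b, st j = lmonom pit 0 * b) /\
          (forall j, (H j).@[st] = 0),
        forall st' : 'I_m -> laurent vt,
          (forall j, exists b, st' j = lmonom pit 0 * b) ->
          (forall j, (H j).@[st'] = 0) -> st' = st,
        forall j, st j = xi (s j) &
        forall i, xidag (phi (qpi Adag (dagger_of_poly 'X_i)))
          = xi (psi (tate_of_poly 'X_i))
            + \sum_l xi (psi (tate_of_poly (P i l))) * st l].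
Proof.
move=> xi xidag H.
pose xiM : {rmorphism tate v m.+1 -> laurent vt} := xihat \o qpi Ahat.
have xiD g h : xi (g + h) = xi g + xi h by exact: (rmorphD xiM).
have xiMl g h : xi (g * h) = xi g * xi h by exact: (rmorphM xiM).
have pp : prime p by case: hQp.
have q0 : (0 < p ^ a)%N by rewrite expn_gt0 prime_gt0.
have pi_p : cdvd pi p%:R.
  apply: uniformiser_dvd => //; rewrite -[vval _]/(\val _) rmorph_nat.
  exact: padic_prime_vge hQp hv.
(* A constant is a global section of [Ct], so its germ at [eta] can be compared with its germ at
   [Q z], where the completion fixes its expansion. *)
have xiC c : xi (tate_of_poly c%:MP) = lmonom (incl c) 0.
  rewrite /xi hxihat pres_scalar (pull_preim_const_sec U c hpr.1).
  rewrite (germ_res Oeta _ (I : oset (opT Ct) eta)).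
  by rewrite (hxieta _ (I : oset (opT Ct) (Q z))); case: hxiq.
have pit_dvd : cdvd pit (incl pi).
  apply: uniformiser_dvd => //; rewrite hincl.
  by apply: extends_vge hvt _; rewrite /vge hpi.2 lexx orbT.
have pit_pi : cdvd (lmonom pit 0) (xi (tate_of_poly pi%:MP)).
  by rewrite xiC; apply: lmonom0_dvd.
have xif j : xi (tate_of_poly (f j)) = 0.
  rewrite /xi (_ : qpi Ahat _ = 0) ?rmorph0 //; apply/qpi_ker.
  by apply: is_ideal_gen; exists j.
have HE j T : (H j).@[T] =
    mmap (xiM \o psi \o @tate_of_poly _ v m.+1 \o @mpolyC m.+1 (vring v))
    (fun i => xi (psi (tate_of_poly 'X_i))
              + \sum_l xi (psi (tate_of_poly (P i l))) * T l) (f j).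
  exact: (@meval_Gsys _ _ _ _ _ xiM).
have xis_pi j : cdvd (lmonom pit 0) (xi (s j)).
  by have [b ->] := s_pi j; rewrite xiMl; apply: cdvdMr.
have xis_sol j : (H j).@[xi \o s] = 0.
  by rewrite -[LHS](rmorph_meval xiM) s_sol rmorph0.
(* [psi] of [f j] is its [p ^ a]-th power modulo [pi], and [xi] kills that power. *)
have psif j : cdvd (lmonom pit 0) (xi (psi (tate_of_poly (f j)))).
  have frob x : cdvd pi (sigmaR x - x ^+ (p ^ a)).
    by have [b ->] := sigma_frob x; exists b; rewrite addrC addKr.
  have [b] := frobenius_lift_dvd (f j) pp pi_p frob psi_semilinear psi_X.
  move/(congr1 xiM); rewrite rmorphB rmorphXn rmorphM /= -!/(xi _) xif.
  rewrite expr0n (gtn_eqF q0) subr0 => e.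
  by rewrite e; apply: cdvdMr.
exists (xi \o s); split => //.
- move=> T cT HT; symmetry.
  apply: (@hensel_unique _ _ _ _ (xiM \o psi \o @tate_of_poly _ v m.+1)
    (lmonom pit 0) f (fun i l => xi (psi (tate_of_poly (P i l))))) => //.
  + by move=> x; apply: uniformiser_power_sep.
  (* Under [xi \o psi] the terms in [f j] and in [pi] of the relation [hP] both become divisible by
     [pit]. *)
  + move=> j l; have [E /matrixP/(_ j l)] := hP.
    rewrite !mxE summxE => /(congr1 (xiM \o psi \o @tate_of_poly _ v m.+1)).
    rewrite rmorph_sum !rmorphD rmorph_sum rmorph_nat.
    under eq_bigr => i _ do rewrite rmorphM mxE.
    move=> ->; rewrite addrC !addrA addNr add0r; apply: cdvdD.
      by apply: cdvd_sum => i; rewrite mxE rmorphM; apply: cdvdMr; apply: psif.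
    rewrite rmorphM; apply: cdvdMr.
    rewrite /= psi_semilinear -/(xi _) xiC; apply: lmonom0_dvd.
    (* Here [sigmaR pi] is [pi ^+ (p ^ a) + pi * b], a multiple of [pi] since the exponent is
       positive. *)
    apply: cdvd_trans pit_dvd _; have [b ->] := sigma_frob pi.
    rewrite -(prednK q0) exprS -mulrDr rmorphM.
    by apply: cdvdMr; exists 1; rewrite mulr1.
  + by move=> j; rewrite -!HE HT xis_sol.
(* [iota] carries the overconvergent representative [y i] to the restricted series of [hy], which
   [xi] expands term by term. *)
- move=> i; rewrite /xidag phi_X hiota hy -/(xi _) xiD.
  rewrite [xi (\sum_l _)](raddf_sum xiM); congr (_ + _); apply: eq_bigr => l _.
  exact: xiMl.
Qed.
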